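(* Consider a channel with side information described by the conditional probability measures $W_{Q_v}(\cdot|x)$ on $(Y,\mathcal{B}_Y)$, $x\in X$, $v\in V$, together with a weak* closed collection of input probability measures $\mathscr{P}_A(X)\subseteq\mathscr{P}(X)$. Suppose there exists a measure $T$ on $(Y,\mathcal{B}_Y)$ such that $W_{Q_v}(\cdot|x)\ll T$ for all $x\in X$, $v\in V$, with density function $f_{T,Q_v}(y|x)=\frac{dW_{Q_v}(\cdot|x)}{dT}(y)$. Suppose that: (a) the function $(x,y,v)\mapsto f_{T,Q_v}(y|x)$ is continuous over $X\times Y\times V$, and the function $f_{T,Q_v}(y|x)\log_2 f_{T,Q_v}(y|x)$ is uniformly integrable over $\{T\times P\times R \mid P\in\mathscr{P}_A(X)\}$; (b) for each fixed $y\in Y$ and $v\in V$, the function $x\mapsto f_{T,Q_v}(y|x)$ is uniformly integrable over $\mathscr{P}_A(X)$. Then the mutual information function $P\mapsto I(P,W_{Q_v}|R)$ is bounded and weak* continuous over $\mathscr{P}_A(X)$.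
   Context: Setting. $X,Y,S,V$ (input, output, state and side-information alphabets) are separable locally compact Hausdorff spaces (e.g. $\mathbb{R}^n$ or $\mathbb{C}^n$) with Borel $\sigma$-algebras $\mathcal{B}_X,\mathcal{B}_Y,\mathcal{B}_S,\mathcal{B}_V$. $\mathscr{P}(X)$ denotes the set of Radon probability measures on $(X,\mathcal{B}_X)$, and similarly for the other spaces. For each $x\in X$, $s\in S$, $W(\cdot|x,s)\in\mathscr{P}(Y)$; for each $v\in V$, $Q_v$ is a (conditional) probability measure on $(S,\mathcal{B}_S)$; $R$ is a probability measure on $(V,\mathcal{B}_V)$. All of these depend measurably on their parameters. The channel with side information is $W_{Q_v}(E|x)=\int W(E|x,s)\,dQ_v(s)$, $E\in\mathcal{B}_Y$. For $P\in\mathscr{P}(X)$, $PW_{Q_v}$ is the output measure $PW_{Q_v}(B)=\int W_{Q_v}(B|x)\,dP(x)$, $B\in\mathcal{B}_Y$. Relative entropy: $D(P\|Q)=\int\log_2\frac{dP}{dQ}\,dP$ if $P\ll Q$, and $+\infty$ otherwise. Mutual information: $I(P,W_{Q_v}|R)=\iint D(W_{Q_v}(\cdot|x)\|PW_{Q_v})\,dP(x)\,dR(v)$. Weak* convergence: $P_n\xrightarrow{w^*}P$ iff $\int f\,dP_n\to\int f\,dP$ for every bounded continuous $f:X\to\mathbb{R}$. A functional on a set of probability measures is weak* continuous if $P_n\xrightarrow{w^*}P$ in the set implies convergence of the values of the functional. Uniform integrability over a collection of measures: a function $f$ is uniformly integrable over a collection $\mathscr{C}$ of measures if $\sup_{\mu\in\mathscr{C}}\int_{\{|f|>c\}}|f|\,d\mu\to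 0$ as $c\to\infty$. The convention $0\log_2 0=0$ is used.
   Formalization: The measure T is taken to be finite: for infinite T the claim fails (X=Y=ℕ, W(·|x)=δ_x, T counting measure, all inputs allowed: (a) and (b) hold but I(P)=H(P) is unbounded); the density is taken nonnegative and jointly measurable. *)

(* Defs.v *)
From HB Require Import structures.
From mathcomp Require Import all_boot all_order all_algebra.
From mathcomp Require Import all_classical all_reals all_analysis.
From mathcomp Require Import measurable_realfun.
Set Implicit Arguments.
Unset Strict Implicit.
Unset Printing Implicit Defensive.
Import Order.TTheory GRing.Theory Num.Theory.
Import numFieldNormedType.Exports.
Local Open Scope classical_set_scope.
Local Open Scope ring_scope.

(* [borel X] is convertible to [X]; it carries the Borel sigma-algebra. *)
Definition borel (X : ptopologicalType) : measurableType (@open X).-sigma :=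
  g_sigma_algebraType (@open X).

Definition separable_lch (X : ptopologicalType) : Prop :=
  [/\ exists2 D : set X, countable D & dense D,
      locally_compact [set: X] & hausdorff_space X].

Section radon_weak_star.
Context (R : realType) (X : ptopologicalType).
Local Open Scope ereal_scope.

Definition radon (mu : set (borel X) -> \bar R) : Prop :=
  [/\ forall K : set X, compact K -> mu K < +oo,
      forall E : set (borel X), measurable E ->
        mu E = ereal_inf [set mu U | U in [set U : set X | open U /\ E `<=` U]]
    & forall U : set X, open U ->
        mu U = ereal_sup [set mu K | K in [set K : set X | compact K /\ K `<=` U]] ].

Definition bounded_continuous (h : X -> R) : Prop :=
  continuous h /\ bounded_fun h.

Definition wstar_cvg (P_ : nat -> probability (borel X) R)
    (P : probability (borel X) R) : Prop :=
  forall h : X -> R, bounded_continuous h ->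
    \int[P_ n]_x (h x)%:E @[n --> \oo] --> \int[P]_x (h x)%:E.

(* [wstar_nbhs P hs e] is a basic neighbourhood of [P] in the weak* topology,
   i.e. the coarsest topology making all the maps P |-> \int h dP, with [h]
   bounded and continuous, continuous. *)
Definition wstar_nbhs (P : probability (borel X) R) (n : nat)
    (hs : 'I_n -> X -> R) (e : R) : set (probability (borel X) R) :=
  [set P' : probability (borel X) R | forall i : 'I_n,
     `|\int[P']_x (hs i x)%:E - \int[P]_x (hs i x)%:E| < e%:E].

(* closedness relative to the set of Radon probability measures *)
Definition wstar_closed (A : set (probability (borel X) R)) : Prop :=
  forall P : probability (borel X) R, radon P ->
    (forall (n : nat) (hs : 'I_n -> X -> R) (e : R),
        (forall i, bounded_continuous (hs i)) -> (0 < e)%R ->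
        A `&` wstar_nbhs P hs e !=set0) ->
    A P.

Definition wstar_continuous_on (A : set (probability (borel X) R))
    (F : probability (borel X) R -> \bar R) : Prop :=
  forall (P_ : nat -> probability (borel X) R) (P : probability (borel X) R),
    (forall n, A (P_ n)) -> A P -> wstar_cvg P_ P ->
    F (P_ n) @[n --> \oo] --> F P.

Definition bounded_on (A : set (probability (borel X) R))
    (F : probability (borel X) R -> \bar R) : Prop :=
  exists M : R, forall P, A P -> `|F P| <= M%:E.

End radon_weak_star.

Section information.
Context d (T : measurableType d) (R : realType).
Local Open Scope ereal_scope.

Definition log2 (x : R) : R := (ln x / ln 2)%R.

(* The values of [ln] and [fine] outside their domains are immaterial: the
   derivative is finite, and it is positive [nu]-almost everywhere. *)
Definition relative_entropy (nu mu : probability T R) : \bar R :=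
  if `[< nu `<< mu >] then
    \int[nu]_t (log2 (fine (Radon_Nikodym (charge_of_finite_measure nu) mu t)))%:E
  else +oo.

Definition is_density (nu mu : {measure set T -> \bar R}) (g : T -> R) : Prop :=
  [/\ measurable_fun [set: T] g, (forall t, (0 <= g t)%R) &
      forall E, measurable E -> nu E = \int[mu]_(t in E) (g t)%:E].

(* The element 0 is only there to make the supremum over the empty
   collection equal to 0. *)
Definition uniformly_integrable (C : set {measure set T -> \bar R})
    (g : T -> R) : Prop :=
  ereal_sup ([set 0] `|`
    [set \int[mu]_(t in [set t | (c < `|g t|)%R]) (`|g t|)%:E
    | mu in C]) @[c --> +oo%R] --> 0.

End information.

Definition product3 d1 d2 d3 (T1 : measurableType d1) (T2 : measurableType d2)
    (T3 : measurableType d3) (R : realType)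
    (m1 : {finite_measure set T1 -> \bar R}) (m2 : probability T2 R)
    (m3 : probability T3 R) : {measure set (T1 * T2 * T3) -> \bar R} :=
  ((m1 \x m2) \x m3)%E.

Section side_information.
Context dX dY dS dV (X : measurableType dX) (Y : measurableType dY)
  (S : measurableType dS) (V : measurableType dV) (R : realType).
Variables (W : R.-pker (X * S) ~> Y) (Q : R.-pker V ~> S).
Local Open Scope ereal_scope.

Definition side_channel (v : V) (x : X) (E : set Y) : \bar R :=
  \int[Q v]_s W (x, s) E.

Section side_channel_probability.
Variables (v : V) (x : X).

Let side_channel0 : side_channel v x set0 = 0.
Proof. by apply: integral0_eq => s _; rewrite measure0. Qed.

Let side_channel_ge0 E : 0 <= side_channel v x E.
Proof. by apply: integral_ge0 => s _; exact: measure_ge0. Qed.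

Let side_channel_sigma_additive : semi_sigma_additive (side_channel v x).
Proof.
move=> F mF tF mUF; rewrite [X in _ --> X](_ : _ =
    \int[Q v]_s (\sum_(n <oo) W (x, s) (F n))); last first.
  by apply: eq_integral => s _; apply/esym/cvg_lim => //;
    exact/measure_semi_sigma_additive.
apply/cvg_closeP; split.
  by apply: is_cvg_nneseries => n _ _; exact: integral_ge0.
rewrite closeE// integral_nneseries// => n.
apply: (measurable_comp measurableT _ (measurable_kernel W _ (mF n))
  (pair1_measurable x)) => //.
Qed.

HB.instance Definition _ := isMeasure.Build _ _ R (side_channel v x)
  side_channel0 side_channel_ge0 side_channel_sigma_additive.

Let side_channelT : side_channel v x [set: Y] = 1.
Proof.
rewrite /side_channel (eq_integral (cst 1)) ?integral_cst//=.
  by rewrite mul1e prob_kernel.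
by move=> s _; rewrite prob_kernel.
Qed.

HB.instance Definition _ :=
  Measure_isProbability.Build _ _ R (side_channel v x) side_channelT.

End side_channel_probability.

Section measurability_in_the_input.
Variable v : V.

Let constQ (_ : X) : {measure set S -> \bar R} := Q v.

Let measurable_constQ U : measurable U -> measurable_fun [set: X] (constQ ^~ U).
Proof. by []. Qed.

HB.instance Definition _ :=
  isKernel.Build _ _ X S R constQ measurable_constQ.

Let constQT x : constQ x [set: S] = 1.
Proof. exact: prob_kernel. Qed.

HB.instance Definition _ :=
  Kernel_isProbability.Build _ _ X S R constQ constQT.

Lemma measurable_side_channel E : measurable E ->
  measurable_fun [set: X] (fun x => side_channel v x E).
Proof.
move=> mE; pose k (p : X * S) := W p E.
have k0 p : 0 <= k p by exact: measure_ge0.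
apply: (measurable_fun_integral_finite_kernel k (constQ : R.-fker X ~> S)) => //.
exact: measurable_kernel.
Qed.

End measurability_in_the_input.

Definition output (P : probability X R) (v : V) (E : set Y) : \bar R :=
  \int[P]_x side_channel v x E.

Section output_probability.
Variables (P : probability X R) (v : V).

Let output0 : output P v set0 = 0.
Proof. by apply: integral0_eq => x _; rewrite measure0. Qed.

Let output_ge0 E : 0 <= output P v E.
Proof. by apply: integral_ge0 => x _; exact: measure_ge0. Qed.

Let output_sigma_additive : semi_sigma_additive (output P v).
Proof.
move=> F mF tF mUF; rewrite [X in _ --> X](_ : _ =
    \int[P]_x (\sum_(n <oo) side_channel v x (F n))); last first.
  by apply: eq_integral => x _; apply/esym/cvg_lim => //;
    exact/measure_semi_sigma_additive.
apply/cvg_closeP; split.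
  by apply: is_cvg_nneseries => n _ _; exact: integral_ge0.
rewrite closeE// integral_nneseries// => n.
exact: measurable_side_channel.
Qed.

HB.instance Definition _ := isMeasure.Build _ _ R (output P v)
  output0 output_ge0 output_sigma_additive.

Let outputT : output P v [set: Y] = 1.
Proof.
rewrite /output (eq_integral (cst 1)) ?integral_cst//=.
  by rewrite mul1e probability_setT.
by move=> x _; rewrite probability_setT.
Qed.

HB.instance Definition _ :=
  Measure_isProbability.Build _ _ R (output P v) outputT.

End output_probability.

Definition mutual_information (rho : probability V R) (P : probability X R) :
    \bar R :=
  \int[rho]_v \int[P]_x relative_entropy (side_channel v x) (output P v).

End side_information.

(* Main.v *)
(* Put [phi t = t log2 t] and let [g] be the average of the density [f] over the
   input law [P], so that [g] is the density of the output law.  Then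
     I(P) = \int phi(f) d(T x P x R) - \int phi(g) d(T x R).
   As [phi + 1 / ln 2 >= 0], and [f log2 (f / g) + g / ln 2 >= 0] by
   [ln u <= u - 1], this identity is a computation with integrals of nonnegative
   functions.
   Truncating [phi] at a level [c] gives bounded continuous integrands, for which
   weak* convergence and dominated convergence apply.  For the first term, the
   excess [(phi(f) - c)^+] is uniformly small over the collection by uniform
   integrability.  Since [(phi - c)^+] is convex, Jensen's inequality bounds
   [(phi(g) - c)^+] by the average of [(phi(f) - c)^+], so the same control holds
   for the second term; the pointwise convergence of [g] comes from
   hypothesis (b), by the same truncation. *)
Require Import Defs.
From HB Require Import structures.
From mathcomp Require Import all_boot all_order all_algebra.
From mathcomp Require Import all_classical all_reals all_analysis.
From mathcomp Require Import measurable_realfun.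
From mathcomp Require Import ring lra.
Set Implicit Arguments.
Unset Strict Implicit.
Unset Printing Implicit Defensive.
Import Order.TTheory GRing.Theory Num.Theory.
Import numFieldNormedType.Exports.
Local Open Scope classical_set_scope.
Local Open Scope ring_scope.

(** * The function t log2 t: tangent lines, lower bounds and continuity *)

Section xlog2.
Context {R : realType}.
Implicit Types (s t c : R) (u : R).

Definition xlog2 t : R := t * log2 t.

Lemma ln2_gt0 : 0 < ln 2 :> R.
Proof. by rewrite ln_gt0// ltr1n. Qed.

(** The left side is the tangent line at [s] of the convex function t ln t. For [t > 0] the bound is
    ln u <= u - 1 at u = s / t, multiplied by [t]. *)
Lemma xln_tangent s t : 0 < s -> 0 <= t -> t * ln s + (t - s) <= t * ln t.
Proof.
move=> s0; rewrite le_eqVlt => /predU1P[<-|t0].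
  by rewrite !mul0r add0r sub0r lerNl oppr0 ltW.
have := @le_ln1Dx R (s / t - 1).
rewrite ltrBrDl subrr divr_gt0// addrCA subrr addr0 => /(_ erefl).
rewrite ln_div ?posrE// => /(ler_wpM2l (ltW t0)).
by rewrite mulrBr mulrBr mulr1 mulrCA divff ?gt_eqF// mulr1; lra.
Qed.

Lemma xlog2_tangent s t : 0 < s -> 0 <= t ->
  xlog2 s + (log2 s + (ln 2)^-1) * (t - s) <= xlog2 t.
Proof.
move=> s0 t0; rewrite /xlog2 /log2 -(ler_pM2r ln2_gt0).
have H := xln_tangent s0 t0; have l2 := lt0r_neq0 ln2_gt0.
rewrite [leLHS](_ : _ = t * ln s + (t - s)); last by field.
by rewrite [leRHS](_ : _ = t * ln t)//; field.
Qed.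

(** The tangent at 1 is increasing and takes the value [- (ln 2)^-1] at 0. The constant is not
    sharp; it is the shift used below to make integrands nonnegative. *)
Lemma xlog2_ge t : 0 <= t -> - (ln 2)^-1 <= xlog2 t.
Proof.
move=> t0; apply: le_trans (xlog2_tangent (@ltr01 R) t0).
rewrite /xlog2 /log2 ln1 !(mul0r, mulr0, add0r) mulrBr mulr1 -subr_ge0.
by rewrite opprK subrK mulr_ge0// invr_ge0 ltW// ln2_gt0.
Qed.

(** The tangent inequality reads t ln (t / s) + s >= t. The correction [s / ln 2] makes a divergence
    integrand nonnegative at the cost of a term with an explicit integral. *)
Lemma xlog2_ratio_ge s t : 0 <= s -> 0 <= t ->
  0 <= t * log2 (t / s) + s / ln 2.
Proof.
rewrite le_eqVlt => /predU1P[<- _|s0].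
  (* For [s = 0] the quotient [t / s] is 0 and [ln 0] is 0, so the sum vanishes. *)
  by rewrite invr0 mulr0 /log2 ln0// !mul0r mulr0 addr0.
rewrite le_eqVlt => /predU1P[<-|t0].
  by rewrite mul0r add0r divr_ge0// ltW// ln2_gt0.
rewrite /log2 ln_div ?posrE// mulrA -mulrDl divr_ge0// ?(ltW ln2_gt0)//.
by have := xln_tangent s0 (ltW t0); rewrite mulrBr; lra.
Qed.

Lemma xlog2_ratio s t : 0 < s -> 0 <= t ->
  t * log2 (t / s) = xlog2 t - t * log2 s.
Proof.
move=> s0; rewrite le_eqVlt /xlog2 => /predU1P[<-|t0].
  by rewrite !mul0r subr0.
by rewrite /log2 ln_div ?posrE// mulrBl mulrBr.
Qed.

(** With r = sqrt t, one has t ln t = 2 r (r ln r), and r ln r >= r - 1 >= -1. This gives the limit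
    of t ln t at 0. *)
Lemma xln_le_sqrt t : 0 <= t <= 1 -> `|t * ln t| <= 2 * Num.sqrt t.
Proof.
move=> /andP[t0 t1]; rewrite ler0_norm; last first.
  by rewrite mulr_ge0_le0// ln_le0.
move: t0; rewrite le_eqVlt => /predU1P[<-|t0].
  by rewrite mul0r oppr0 mulr_ge0// sqrtr_ge0.
have s0 : 0 < Num.sqrt t by rewrite sqrtr_gt0.
have st : t = Num.sqrt t * Num.sqrt t by rewrite -expr2 sqr_sqrtr// ltW.
have lnt : ln t = ln (Num.sqrt t) + ln (Num.sqrt t).
  by rewrite {1}st lnM ?posrE.
have := xln_tangent (@ltr01 R) (ltW s0).
rewrite ln1 mulr0 add0r => /(ler_wpM2l (ltW s0)).
rewrite mulrA mulrBr mulr1 -st => h.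
by rewrite lnt mulrDr; lra.
Qed.

Lemma continuous_xlog2 : continuous xlog2.
Proof.
suff h : continuous (fun t : R => t * ln t).
  by move=> t; rewrite /xlog2 /log2; under eq_fun do rewrite mulrA;
    apply: cvgMl; exact: h.
move=> t; have [t0|t0|->] := ltgtP t 0.
- rewrite /continuous_at ln0 ?ltW// mulr0; apply: cvg_near_cst.
  near=> s; rewrite ln0 ?mulr0//; apply/ltW.
  by near: s; exact: lt_nbhsl.
- by apply: cvgM; [exact: cvg_id|exact: continuous_ln].
(* To the right of 0 the square root bound applies; to the left the function is 0, because [ln]
   vanishes there. *)
- rewrite /continuous_at mul0r; apply/cvgr0Pnorm_le => e e0.
  have : Num.sqrt s @[s --> (0 : R)] --> Num.sqrt (0 : R).
    exact: sqrt_continuous.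
  rewrite sqrtr0 => /cvgr0Pnorm_le/(_ (e / 2)) H.
  near=> s; have [s0|s0] := leP s 0.
    by rewrite ln0// mulr0 normr0 ltW.
  rewrite (le_trans (xln_le_sqrt _))//.
    rewrite (ltW s0)/= ltW//; near: s; exact: lt_nbhsl.
  rewrite mulrC -ler_pdivlMr// -[leLHS]ger0_norm ?sqrtr_ge0//.
  by near: s; apply: H; rewrite divr_gt0.
Unshelve. all: by end_near. Qed.

Lemma measurable_xlog2 : measurable_fun [set: R] xlog2.
Proof. exact: continuous_measurable_fun continuous_xlog2. Qed.

End xlog2.

(** * Integrals of a nonnegative function plus an integrable one, and measurability of composites *)

Section integral.
Context d (T : measurableType d) (R : realType).
Variable mu : {measure set T -> \bar R}.
Local Open Scope ereal_scope.

(** If [w] has an infinite integral, so does the positive part of the sum, while the negative part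
    is at most [|k|]. Integrands can thus be shifted by integrable terms before anything is known to
    be finite. *)
Lemma integral_ge0D_integrable (w : T -> \bar R) (k : T -> R) :
  (forall t, 0 <= w t) -> measurable_fun [set: T] w ->
  mu.-integrable [set: T] (EFin \o k) ->
  \int[mu]_t (w t + (k t)%:E) = \int[mu]_t w t + \int[mu]_t (k t)%:E.
Proof.
move=> w0 mw ik; have mk := measurable_int _ ik.
have [woo|] := ltP (\int[mu]_t w t) +oo.
  apply: integralD => //; apply/integrableP; split => //.
  by under eq_integral do rewrite gee0_abs//.
rewrite leye_eq => /eqP woo; rewrite woo.
pose u t := w t + (k t)%:E.
have mu_ : measurable_fun [set: T] u by exact: emeasurable_funD.
have kE : \int[mu]_t `|(k t)%:E| < +oo by case/integrableP : ik.
have kfin : \int[mu]_t (k t)%:E \is a fin_num by exact: integrable_fin_num.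
have uneg t : u^\- t <= `|(k t)%:E|.
  rewrite funenegE /u; case: (w t) (w0 t) => [r||]//= r0; last first.
    by rewrite ge_max leNye lee_fin normr_ge0.
  rewrite -EFin_max lee_fin ge_max normr_ge0 andbT.
  by rewrite -normrN (le_trans _ (ler_norm _))// opprD gerDr oppr_le0.
have unegoo : \int[mu]_t u^\- t < +oo.
  apply: le_lt_trans kE; apply: ge0_le_integral => //.
  - exact: measurable_funeneg.
  - by apply: measurableT_comp => //.
(* Otherwise [w], being at most [u^\+ + |k|], would have a finite integral. *)
have uposoo : \int[mu]_t u^\+ t = +oo.
  apply/eqP; rewrite -leye_eq leNgt; apply/negP => uoo.
  suff : \int[mu]_t w t < +oo by rewrite woo.
  apply: (@le_lt_trans _ _ (\int[mu]_t (u^\+ t + `|(k t)%:E|))).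
    apply: ge0_le_integral => //.
    - apply: emeasurable_funD; first exact: measurable_funepos.
      by apply: measurableT_comp => //.
    - move=> t _; rewrite funeposE /u.
      case: (w t) (w0 t) => [r||]//= r0.
      rewrite -EFin_max lee_fin.
      rewrite (@le_trans _ _ (r + k t + `|k t|)%R)//; last first.
        by rewrite lerD2r le_max lexx.
      by have := ler_norm (- k t)%R; rewrite normrN; lra.
  rewrite ge0_integralD//; [|exact: measurable_funepos|].
  - by rewrite lte_add_pinfty.
  - by apply: measurableT_comp => //.
rewrite integralE uposoo !addye//.
  by rewrite -(fineK kfin).
by rewrite eqe_oppLR/= lt_eqF.
Qed.

Lemma measurable_xlog2_comp (f : T -> R) : measurable_fun [set: T] f ->
  measurable_fun [set: T] (fun t => xlog2 (f t)).
Proof. by move=> mf; exact: measurableT_comp measurable_xlog2 mf. Qed.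

Lemma measurable_log2_comp (f : T -> R) : measurable_fun [set: T] f ->
  measurable_fun [set: T] (fun t => log2 (f t)).
Proof.
by move=> mf; apply: measurable_funM => //; exact: measurableT_comp mf.
Qed.

Lemma measurable_ratio (f g : T -> R) : measurable_fun [set: T] f ->
  measurable_fun [set: T] g -> (forall t, 0 <= g t)%R ->
  measurable_fun [set: T] (fun t => f t / g t)%R.
Proof.
move=> mf mg g0; apply: measurable_funM => //.
(* On nonnegative reals, 0 included, the inverse is the power with exponent -1, and powers are
   measurable. *)
rewrite (_ : (fun t => _) = (fun t => g t `^ (-1)))%R.
  by apply: (measurableT_comp (measurable_powR _)).
by apply/funext => t; rewrite powR_inv1.
Qed.

End integral.

(** * Change of variables along a density *)

Section density.
Context d (T : measurableType d) (R : realType).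
Variables (nu mu : {finite_measure set T -> \bar R}) (g : T -> R).
Hypothesis dg : is_density nu mu g.
Local Open Scope ereal_scope.

Lemma density_dominates : nu `<< mu.
Proof.
case: dg => mg g0 nuE; apply/null_content_dominatesP => E mE E0.
rewrite nuE//; apply: null_set_integral => //.
exact/measurable_EFinP/measurable_funTS.
Qed.

(** The formula holds for the Radon-Nikodym derivative, and [g] equals it [mu]-almost everywhere,
    since both integrate to [nu E] over every measurable [E]. *)
Lemma ge0_integral_density (k : T -> \bar R) : (forall t, 0 <= k t) ->
  measurable_fun [set: T] k -> \int[nu]_t k t = \int[mu]_t (k t * (g t)%:E).
Proof.
move=> k0 mk; case: dg => mg g0 nuE.
have numu := density_dominates.
rewrite -(Radon_Nikodym_SigmaFinite.change_of_variables numu)//.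
have iRN := Radon_Nikodym_SigmaFinite.f_integrable numu.
apply: ae_eq_integral => //.
- by apply: emeasurable_funM => //; exact: measurable_int iRN.
- by apply: emeasurable_funM => //; exact/measurable_EFinP.
- apply: ae_eqe_mul2l; apply: integral_ae_eq => //; first exact/measurable_EFinP.
  by move=> E _ mE; rewrite -Radon_Nikodym_SigmaFinite.f_integral// nuE.
Qed.

(** Taking positive and negative parts commutes with multiplication by [g >= 0], so the nonnegative
    case suffices and [k] need not be integrable. *)
Lemma integral_density (k : T -> R) : measurable_fun [set: T] k ->
  \int[nu]_t (k t)%:E = \int[mu]_t (k t * g t)%:E.
Proof.
move=> mk; case: (dg) => mg g0 nuE.
have mk' : measurable_fun [set: T] (EFin \o k) by exact/measurable_EFinP.
rewrite integralE [RHS]integralE; congr (_ - _).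
- rewrite ge0_integral_density//; last exact: measurable_funepos.
  by apply: eq_integral => t _; rewrite !funeposE -!EFin_max -EFinM maxr_pMl// mul0r.
- rewrite ge0_integral_density//; last exact: measurable_funeneg.
  by apply: eq_integral => t _;
    rewrite !funenegE -!EFin_max -EFinM maxr_pMl// mul0r mulNr.
Qed.

End density.

(** * Relative entropy in terms of densities with respect to a common measure *)

Section relative_entropy.
Context d (T : measurableType d) (R : realType).
Variables (nu mu : probability T R) (tau : {finite_measure set T -> \bar R}).
Variables (f g : T -> R).
Hypotheses (df : is_density nu tau f) (dg : is_density mu tau g).
Local Open Scope ereal_scope.

Let mf : measurable_fun [set: T] f. Proof. by case: df. Qed.
Let mg : measurable_fun [set: T] g. Proof. by case: dg. Qed.

Let Z := [set t | g t = 0%R].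

Let mZ : measurable Z.
Proof. by rewrite -[Z]setTI; exact: mg (measurable_set1 _). Qed.

Let muZ : mu Z = 0.
Proof.
case: dg => _ _ ->//; rewrite integral0_eq// => t; rewrite /Z/= => ->//.
Qed.

(** Domination of [nu] by [mu] amounts to [nu Z = 0], and the derivative is then [f / g]. Testing a
    single measurable set makes the divergence measurable in the channel input later on. *)
Lemma relative_entropy_density :
  relative_entropy nu mu =
  if nu Z == 0 then \int[tau]_t (f t * log2 (f t / g t))%:E else +oo.
Proof.
rewrite /relative_entropy; case: asboolP => [numu|nnumu]; last first.
  (* If [nu Z = 0], every [mu]-null set [E] is [nu]-null: [g > 0] on [E] minus [Z], so that part is
     [tau]-null, hence [nu]-null. *)
  case: eqP => // nuZ; exfalso; apply: nnumu.
  apply/null_content_dominatesP => E mE muE.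
  apply/eqP; rewrite eq_le measure_ge0 andbT.
  have mEZ : measurable (E `\` Z) by exact: measurableD.
  have nuEZ : nu (E `&` Z) = 0.
    apply/eqP; rewrite eq_le measure_ge0 andbT -nuZ le_measure ?inE//.
    exact: measurableI.
  have nuE : nu E = nu (E `\` Z).
    by rewrite [LHS](measureDI nu mE mZ) [X in _ + X](_ : _ = 0) ?adde0.
  suff H : nu (E `\` Z) = 0 by rewrite -H -nuE.
  have : mu (E `\` Z) = 0.
    by apply/eqP; rewrite eq_le measure_ge0 andbT -muE le_measure ?inE.
  move=> muEZ; apply/((null_content_dominatesP _ _).1 (density_dominates df)) => //.
  case: dg => _ g0 mu_g; move: muEZ; rewrite mu_g// => gEZ.
  have : ae_eq tau (E `\` Z) (EFin \o g) (cst 0).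
    apply/ae_eq_integral_abs => //; first exact/measurable_EFinP/measurable_funTS.
    by rewrite -gEZ; apply: eq_integral => t _ /=; rewrite ger0_norm.
  case=> A [mA A0 sA]; apply/eqP; rewrite eq_le measure_ge0 andbT -A0.
  rewrite le_measure ?inE// => t EZt; apply: sA => /= /(_ EZt) [gt0].
  by case: EZt => _; apply.
have nuZ : nu Z = 0 by apply/((null_content_dominatesP _ _).1 numu).
rewrite nuZ eqxx.
have [_ g0 muE] := dg; have [_ f0 nuE] := df.
pose r := Radon_Nikodym (charge_of_finite_measure nu) mu.
have ir : mu.-integrable [set: T] r by exact: Radon_Nikodym_integrable.
have mr : measurable_fun [set: T] r by exact: measurable_int ir.
have mfg : measurable_fun [set: T] (fun t => f t / g t)%R by exact: measurable_ratio.
have fg0 t : (0 <= f t / g t)%R by rewrite divr_ge0.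
(* Integrating [f / g] against [mu] cancels [g] outside [Z], and [Z] carries no [nu]-mass. *)
have rE : ae_eq mu [set: T] r (fun t => (f t / g t)%:E).
  apply: integral_ae_eq => //; first exact/measurable_EFinP.
  move=> E _ mE; rewrite -Radon_Nikodym_integral//=.
  rewrite integral_mkcond (ge0_integral_density dg); last 2 first.
  - by move=> t; rewrite /patch; case: ifP => // _; rewrite lee_fin.
  - by apply/(measurable_restrictT _ mE)/measurable_funTS/measurable_EFinP.
  have -> : nu E = nu (E `\` Z).
    rewrite [LHS](measureDI _ mE mZ) [X in _ + X](_ : _ = 0) ?adde0//.
    apply/eqP; rewrite eq_le measure_ge0 andbT -nuZ le_measure ?inE//.
    exact: measurableI.
  rewrite nuE; last exact: measurableD.
  rewrite integral_mkcond; apply: eq_integral => t _; rewrite /patch.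
  have [Et|Et] := boolP (t \in E); last first.
    by rewrite mul0e memNset// => -[Et' _]; move: Et; rewrite mem_set.
  have [gt0|gt0] := eqVneq (g t) 0%R.
    by rewrite gt0 mule0 memNset// => -[_]; apply.
  rewrite mem_set; last by split; [exact: set_mem|exact/eqP].
  by rewrite -EFinM divfK.
(* The factor [f] is absorbed as the density of [nu]; the almost everywhere equality then passes
   from [mu] to [nu] by domination. *)
rewrite (_ : \int[tau]_t _ = \int[tau]_t (log2 (f t / g t) * f t)%:E); last first.
  by apply: eq_integral => t _; rewrite mulrC.
rewrite -(integral_density df); last exact: measurable_log2_comp.
apply: ae_eq_integral => //.
- apply/measurable_EFinP/measurable_log2_comp.
  exact: measurableT_comp mr.
- exact/measurable_EFinP/measurable_log2_comp.
have : ae_eq nu [set: T] r (fun t => (f t / g t)%:E).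
  exact: null_dominates_ae_eq rE.
by apply: filterS => t h _; rewrite -/r (h I).
Qed.

End relative_entropy.

(** * Averages of t log2 t over a probability measure, and Jensen's inequality *)

Section average.
Context d (T : measurableType d) (R : realType) (P : probability T R).
Variables (u : T -> R) (a : R).
Hypotheses (mu : measurable_fun [set: T] u) (u0 : forall t, 0 <= u t).
Hypothesis ua : (\int[P]_t (u t)%:E = a%:E)%E.
Local Open Scope ereal_scope.

Let a0 : (0 <= a)%R.
Proof. by rewrite -lee_fin -ua integral_ge0// => t _; rewrite lee_fin. Qed.

Let iu : P.-integrable [set: T] (EFin \o u).
Proof.
apply/integrableP; split; first exact/measurable_EFinP.
under eq_integral do rewrite /= ger0_norm//.
by rewrite ua ltry.
Qed.

Let icst r : P.-integrable [set: T] (EFin \o cst r).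
Proof. exact: finite_measure_integrable_cst. Qed.

Let int_cst r : \int[P]_t r%:E = r%:E.
Proof. by rewrite integral_cst// [X in _ * X]probability_setT mule1. Qed.

Lemma integral_affine r s :
  \int[P]_t (r * u t + s)%:E = (r * a + s)%:E.
Proof.
under eq_integral do rewrite EFinD EFinM.
rewrite integralD//=; [|exact: integrableZl|exact: icst].
by rewrite integralZl//= ua int_cst.
Qed.

Let iaffine r s : P.-integrable [set: T] (EFin \o (fun t => r * u t + s)%R).
Proof.
rewrite (_ : EFin \o _ = (fun t => r%:E * (EFin \o u) t + (EFin \o cst s) t)).
  by apply: integrableD => //; exact: integrableZl.
by apply/funext => t /=; rewrite EFinD EFinM.
Qed.

(* The term [a / ln 2] makes both sides integrals of nonnegative functions, so
   that no integrability of [xlog2 \o u] is required. *)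
Lemma average_xlog2 :
  \int[P]_t (u t * log2 (u t / a) + a / ln 2)%:E + (xlog2 a + (ln 2)^-1)%:E =
  \int[P]_t (xlog2 (u t) + (ln 2)^-1)%:E + (a / ln 2)%:E.
Proof.
have mx : measurable_fun [set: T] (fun t => (xlog2 (u t) + (ln 2)^-1)%:E).
  by apply/measurable_EFinP/measurable_funD => //; exact: measurable_xlog2_comp.
have [aeq0|an0] := eqVneq a 0%R.
  (* With mean 0, [u] vanishes almost everywhere, and both sides equal [(ln 2)^-1]. *)
  have uae : ae_eq P [set: T] (EFin \o u) (cst 0).
    apply/ae_eq_integral_abs => //; first exact/measurable_EFinP.
    transitivity (\int[P]_t (u t)%:E); last by rewrite ua aeq0.
    by apply: eq_integral => t _ /=; rewrite ger0_norm.
  rewrite aeq0 mul0r adde0; under eq_integral.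
    move=> t _; rewrite invr0 mulr0 /log2 ln0// mul0r mulr0 addr0; over.
  rewrite integral0 add0e /xlog2 mul0r add0r -[LHS]int_cst.
  apply: ae_eq_integral => //.
  by apply: filterS uae => t /(_ I) [->] _; rewrite mul0r add0r.
have agt0 : (0 < a)%R by rewrite lt_neqAle eq_sym an0.
(* [k] is the difference of the two integrands: it is affine in [u], hence integrable with an
   explicit integral. *)
pose k t := (- log2 a * u t + (a / ln 2 - (ln 2)^-1))%R.
have -> : \int[P]_t (u t * log2 (u t / a) + a / ln 2)%:E =
    \int[P]_t ((xlog2 (u t) + (ln 2)^-1)%:E + (k t)%:E).
  apply: eq_integral => t _; rewrite xlog2_ratio// -EFinD /k; congr EFin.
  by ring.
rewrite integral_ge0D_integrable//; last 2 first.
- by move=> t; rewrite lee_fin -lerBlDr sub0r xlog2_ge.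
- exact: iaffine.
rewrite integral_affine -addeA -EFinD; congr (_ + EFin _).
by rewrite /xlog2; ring.
Qed.

(** When [xlog2 a > c], the tangent of [xlog2] at [a], lowered by [c], lies below the excess, and
    its average is its value at [a]. *)
Lemma jensen_xlog2_excess c : (0 <= c)%R ->
  (Num.max (xlog2 a - c) 0)%:E <= \int[P]_t (Num.max (xlog2 (u t) - c) 0)%:E.
Proof.
move=> c0; have [ac|ac] := leP (xlog2 a - c)%R 0%R.
  by apply: integral_ge0 => t _; rewrite lee_fin le_max lexx orbT.
have la0 : (0 < a * log2 a)%R by rewrite -/(xlog2 a); lra.
have agt0 : (0 < a)%R.
  by rewrite lt_neqAle a0 andbT; apply: contraTneq la0 => <-; rewrite mul0r ltxx.
(* The slope of the tangent is nonnegative, because [a * log2 a > c >= 0] forces [log2 a > 0]. *)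
have s0 : (0 <= log2 a + (ln 2)^-1)%R.
  by rewrite addr_ge0// ?invr_ge0 ?(ltW ln2_gt0)// ltW// -(pmulr_rgt0 _ agt0).
set s := (log2 a + (ln 2)^-1)%R in s0.
have mmax : measurable_fun [set: T] (fun t => (Num.max (xlog2 (u t) - c) 0)%:E).
  apply/measurable_EFinP/measurable_maxr => //; apply: measurable_funB => //.
  exact: measurable_xlog2_comp.
(* Adding [s * a] to both sides makes both integrands nonnegative, so monotonicity applies without
   integrability of the excess. *)
rewrite -(@leeD2rE _ (s * a)%:E)// -EFinD addrC -integral_affine.
rewrite -[X in _ <= _ + X]int_cst -ge0_integralD//; last 2 first.
- by move=> t _; rewrite lee_fin le_max lexx orbT.
- by move=> t _; rewrite lee_fin mulr_ge0.
apply: ge0_le_integral => //.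
- by move=> t _; rewrite lee_fin addr_ge0 ?mulr_ge0// ltW.
- apply/measurable_EFinP/measurable_funD => //; exact: measurable_funM.
- exact: emeasurable_funD.
move=> t _; rewrite -EFinD lee_fin.
have H : (xlog2 a + (s * u t - s * a) <= xlog2 (u t))%R.
  by rewrite -mulrBr; exact: xlog2_tangent.
by rewrite -lerBlDr le_max; apply/orP; left; lra.
Qed.

End average.

(** * Finite and triple products: measurability and Tonelli's theorem *)

Lemma measurable_fst_snd d1 d2 d3 (A : measurableType d1) (B : measurableType d2)
    (C : measurableType d3) : measurable_fun [set: A * B * C] (fun p => p.1.2).
Proof. exact: measurableT_comp measurable_snd measurable_fst. Qed.

Lemma measurable_fst_fst d1 d2 d3 (A : measurableType d1) (B : measurableType d2)
    (C : measurableType d3) : measurable_fun [set: A * B * C] (fun p => p.1.1).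
Proof. exact: measurableT_comp measurable_fst measurable_fst. Qed.

Section finite_product.
Context d1 d2 (T1 : measurableType d1) (T2 : measurableType d2) (R : realType).
Variables (m1 : {finite_measure set T1 -> \bar R})
  (m2 : {finite_measure set T2 -> \bar R}).
Local Open Scope ereal_scope.

(** A named copy of the product that carries the structure of a finite measure: it can be a factor
    in Tonelli's theorem, and constants are integrable for it. *)
Definition finite_product : set (T1 * T2) -> \bar R := m1 \x m2.

HB.instance Definition _ := Measure.on finite_product.

Let finite_product_fin : fin_num_fun finite_product.
Proof.
move=> A mA; rewrite ge0_fin_numE ?measure_ge0//.
rewrite (@le_lt_trans _ _ (finite_product [set: T1 * T2]))//.
  by rewrite le_measure ?inE.
rewrite /finite_product -setXTT product_measure1E// ltey_eq.
by rewrite fin_numM// fin_num_measure.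
Qed.

HB.instance Definition _ := Measure_isFinite.Build _ _ _ finite_product
  finite_product_fin.

End finite_product.

(** Serves both to permute the variables and, with constant [a], [b] or [c], to freeze some of
    them. *)
Lemma measurable_triple_comp dX dY dV dZ dU (X : measurableType dX)
    (Y : measurableType dY) (V : measurableType dV) (Z : measurableType dZ)
    (U : measurableType dU) (k : X -> Y -> V -> Z)
    (a : U -> X) (b : U -> Y) (c : U -> V) :
  measurable_fun [set: X * Y * V] (fun p => k p.1.1 p.1.2 p.2) ->
  measurable_fun [set: U] a -> measurable_fun [set: U] b ->
  measurable_fun [set: U] c ->
  measurable_fun [set: U] (fun t => k (a t) (b t) (c t)).
Proof.
move=> mk ma mb mc.
by apply: (measurableT_comp mk (g := fun t => (a t, b t, c t)));
  do 2 apply: measurable_fun_pair => //.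
Qed.

Section triple_tonelli.
Context dX dY dV (X : measurableType dX) (Y : measurableType dY)
  (V : measurableType dV) (R : realType).
Variables (T : {finite_measure set Y -> \bar R}) (P : probability X R)
  (rho : probability V R) (k : X -> Y -> V -> \bar R).
Local Open Scope ereal_scope.
Hypothesis mk :
  measurable_fun [set: X * Y * V] (fun p => k p.1.1 p.1.2 p.2).

Hypothesis k0 : forall x y v, 0 <= k x y v.

Lemma measurable_integral_input :
  measurable_fun [set: Y * V] (fun z => \int[P]_x k x z.1 z.2).
Proof.
apply: (measurable_fun_fubini_tonelli_F (m2 := P)
  (fun p : (Y * V) * X => k p.2 p.1.1 p.1.2)) => //.
exact: (measurable_triple_comp mk measurable_snd
  (@measurable_fst_fst _ _ _ Y V X) (@measurable_fst_snd _ _ _ Y V X)).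
Qed.

Lemma measurable_integral_output :
  measurable_fun [set: X * V] (fun z => \int[T]_y k z.1 y z.2).
Proof.
apply: (measurable_fun_fubini_tonelli_F (m2 := T)
  (fun p : (X * V) * Y => k p.1.1 p.2 p.1.2)) => //.
exact: (measurable_triple_comp mk (@measurable_fst_fst _ _ _ X V Y)
  measurable_snd (@measurable_fst_snd _ _ _ X V Y)).
Qed.

Let product_integral_input : \int[(T \x rho)%E]_z \int[P]_x k x z.1 z.2 =
  \int[rho]_v \int[T]_y \int[P]_x k x y v.
Proof.
have := @fubini_tonelli2 _ _ _ _ _ T rho _ measurable_integral_input; apply.
by move=> z; exact: integral_ge0.
Qed.

Let mkyx v : measurable_fun [set: Y * X] (fun q => k q.2 q.1 v).
Proof.
exact: (measurable_triple_comp mk measurable_snd measurable_fst (measurable_cst v)).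
Qed.

(** The left side has the order of factors of the uniform integrability hypothesis; on the right the
    input is innermost, so that averages over it can be compared at each pair (y, v). *)
Lemma integral_product3 : \int[product3 T P rho]_p k p.1.2 p.1.1 p.2 =
  \int[(T \x rho)%E]_z \int[P]_x k x z.1 z.2.
Proof.
have mk' : measurable_fun [set: Y * X * V] (fun p => k p.1.2 p.1.1 p.2).
  exact: (measurable_triple_comp mk (@measurable_fst_snd _ _ _ Y X V)
    (@measurable_fst_fst _ _ _ Y X V) measurable_snd).
have := @fubini_tonelli2 _ _ _ _ _ (finite_product T P) rho _ mk'.
move=> /(_ (fun p => k0 _ _ _)) H; rewrite product_integral_input.
transitivity (\int[rho]_v \int[(T \x P)%E]_q k q.2 q.1 v); first exact: H.
apply: eq_integral => v _.
by have := @fubini_tonelli1 _ _ _ _ _ T P _ (mkyx v); apply.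
Qed.

Lemma integral_product_output : \int[(T \x rho)%E]_z \int[P]_x k x z.1 z.2 =
  \int[rho]_v \int[P]_x \int[T]_y k x y v.
Proof.
rewrite product_integral_input; apply: eq_integral => v _.
by have := @fubini_tonelli _ _ _ _ _ T P _ (mkyx v); apply.
Qed.

End triple_tonelli.

(** * The averaged density and the formula for the mutual information *)

Section average_density.
Context dX dY dV (X : measurableType dX) (Y : measurableType dY)
  (V : measurableType dV) (R : realType).
Variables (P : probability X R) (f : X -> Y -> V -> R) (g : Y * V -> R).
Local Open Scope ereal_scope.
Hypothesis mf : measurable_fun [set: X * Y * V] (fun p => f p.1.1 p.1.2 p.2).
Hypothesis f0 : forall x y v, (0 <= f x y v)%R.
Hypothesis gE : forall y v, \int[P]_x (f x y v)%:E = (g (y, v))%:E.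

Lemma average_density_ge0 z : (0 <= g z)%R.
Proof.
by case: z => y v; rewrite -lee_fin -gE integral_ge0// => x _; rewrite lee_fin.
Qed.

Lemma measurable_average_density : measurable_fun [set: Y * V] g.
Proof.
have mEf : measurable_fun [set: X * Y * V] (fun p => (f p.1.1 p.1.2 p.2)%:E).
  exact/measurable_EFinP.
have := @measurable_integral_input _ _ _ X Y V R P (fun x y v => (f x y v)%:E) mEf.
move=> /(_ (fun x y v => f0 x y v)) H; apply/measurable_EFinP.
by apply: eq_measurable_fun H => -[y v] _; rewrite gE.
Qed.

End average_density.

Section mutual_information_formula.
Context dX dY dS dV (X : measurableType dX) (Y : measurableType dY)
  (S : measurableType dS) (V : measurableType dV) (R : realType).
Variables (W : R.-pker (X * S) ~> Y) (Q : R.-pker V ~> S).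
Variables (rho : probability V R) (P : probability X R).
Variables (T : {finite_measure set Y -> \bar R}) (f : X -> Y -> V -> R).
Variable g : Y * V -> R.
Local Open Scope ereal_scope.
Hypothesis df : forall x v, is_density (side_channel W Q v x) T (fun y => f x y v).
Hypothesis mf : measurable_fun [set: X * Y * V] (fun p => f p.1.1 p.1.2 p.2).
Hypothesis gE : forall y v, \int[P]_x (f x y v)%:E = (g (y, v))%:E.

Let f0 x y v : (0 <= f x y v)%R. Proof. by case: (df x v). Qed.

Let mEf : measurable_fun [set: X * Y * V] (fun p => (f p.1.1 p.1.2 p.2)%:E).
Proof. exact/measurable_EFinP. Qed.

Let g0 := average_density_ge0 f0 gE.
Let mg := measurable_average_density mf f0 gE.

Let mgv v : measurable_fun [set: Y] (fun y => g (y, v)).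
Proof. exact: measurableT_comp mg (pair2_measurable v). Qed.

(** Tonelli's theorem exchanges the average over the input with the integral over [E]. *)
Lemma output_density v : is_density (output W Q P v) T (fun y => g (y, v)).
Proof.
split=> // E mE; rewrite /output.
have fE x : side_channel W Q v x E = \int[T]_y ((f x y v)%:E * (\1_E y)%:E).
  have [_ _ ->//] := df x v; rewrite integral_mkcond; apply: eq_integral => y _.
  by rewrite -EFinM /patch indicE; case: ifP => _; rewrite (mulr1, mulr0).
transitivity (\int[P]_x \int[T]_y ((f x y v)%:E * (\1_E y)%:E)).
  by apply: eq_integral => x _; exact: fE.
have mk : measurable_fun [set: X * Y] (fun q => (f q.1 q.2 v)%:E * (\1_E q.2)%:E).
  apply: emeasurable_funM.
    exact: (measurable_triple_comp (k := fun x y v => (f x y v)%:E) mEf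
      measurable_fst measurable_snd (measurable_cst v)).
  by apply/measurable_EFinP; apply: measurableT_comp.
have := @fubini_tonelli _ _ _ _ _ P T _ mk => /= ->.
  rewrite [RHS]integral_mkcond; apply: eq_integral => y _ /=.
  under eq_integral do rewrite muleC.
  rewrite ge0_integralZl//; last 2 first.
  - exact: (measurable_triple_comp (k := fun x y v => (f x y v)%:E) mEf
      (@measurable_id _ _ _) (measurable_cst y) (measurable_cst v)).
  - by move=> x _; rewrite lee_fin.
  by rewrite gE -EFinM /patch indicE; case: ifP => _; rewrite (mul1r, mul0r).
by move=> q; rewrite -EFinM lee_fin mulr_ge0.
Qed.

(** The divergence integrand, made nonnegative. The added term integrates to [(ln 2)^-1] over [y],
    because [g] is the density of a probability measure. *)
Let h x y v := (f x y v * log2 (f x y v / g (y, v)) + g (y, v) / ln 2)%R.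

Let h0 x y v : 0 <= (h x y v)%:E.
Proof. by rewrite lee_fin xlog2_ratio_ge. Qed.

Let mh : measurable_fun [set: X * Y * V] (fun p => (h p.1.1 p.1.2 p.2)%:E).
Proof.
have mg' : measurable_fun [set: X * Y * V] (fun p => g (p.1.2, p.2)).
  apply: (measurableT_comp mg (g := fun p : X * Y * V => (p.1.2, p.2))).
  apply: measurable_fun_pair => //.
  exact: measurable_fst_snd.
apply/measurable_EFinP/measurable_funD; apply: measurable_funM => //.
by apply: measurable_log2_comp; exact: measurable_ratio.
Qed.

Let integral_g v : \int[T]_y (g (y, v))%:E = 1.
Proof.
have [_ _ <-//] := output_density v.
exact: (@probability_setT _ _ _ (output W Q P v)).
Qed.

Let ig v : T.-integrable [set: Y] (EFin \o (fun y => - (g (y, v) / ln 2)))%R.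
Proof.
rewrite (_ : EFin \o _ = fun y => (- (ln 2)^-1)%:E * (g (y, v))%:E).
  apply: integrableZl => //; apply/integrableP; split; first exact/measurable_EFinP.
  by under eq_integral do rewrite /= ger0_norm//; rewrite integral_g ltry.
by apply/funext => y /=; rewrite -EFinM mulNr mulrC.
Qed.

Let integral_gN v : \int[T]_y (- (g (y, v) / ln 2))%:E = (- (ln 2)^-1)%:E.
Proof.
under eq_integral do rewrite mulrC -mulNr EFinM.
rewrite integralZl//= ?integral_g ?mule1//.
apply/integrableP; split; first exact/measurable_EFinP.
by under eq_integral do rewrite /= ger0_norm//; rewrite integral_g ltry.
Qed.

Let entropy_density v x :
  \int[T]_y (f x y v * log2 (f x y v / g (y, v)))%:E =
  \int[T]_y (h x y v)%:E + (- (ln 2)^-1)%:E.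
Proof.
rewrite -(integral_gN v) -integral_ge0D_integrable//; last first.
  exact: (measurable_triple_comp (k := fun x y v => (h x y v)%:E) mh
    (measurable_cst x) (@measurable_id _ _ _) (measurable_cst v)).
by apply: eq_integral => y _; rewrite -EFinD addrK.
Qed.

Let mD v : measurable_fun [set: X] (fun x => \int[T]_y (h x y v)%:E).
Proof.
have H := measurable_integral_output T mh h0.
exact: (measurableT_comp H (pair2_measurable v)).
Qed.

Let integral_entropy v :
  \int[P]_x relative_entropy (side_channel W Q v x) (output W Q P v) =
  \int[P]_x \int[T]_y (h x y v)%:E + (- (ln 2)^-1)%:E.
Proof.
pose Z := [set y | g (y, v) = 0%R].
have mZ : measurable Z.
  by rewrite -[Z]setTI; exact: (mgv v) (measurable_set1 _).
have mWZ := measurable_side_channel W Q v mZ.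
(* The output law gives [Z] mass 0, so almost every input does too: the infinite branch of the
   divergence is met only on a [P]-null set. *)
have WZ0 : \int[P]_x side_channel W Q v x Z = 0.
  rewrite -/(output W Q P v Z); have [_ _ ->//] := output_density v.
  by apply: integral0_eq => y; rewrite /Z/= => ->.
have aeZ : ae_eq P [set: X] (fun x => side_channel W Q v x Z) (cst 0).
  by apply/ae_eq_integral_abs => //; under eq_integral do rewrite gee0_abs//.
have REE x := relative_entropy_density (df x v) (output_density v).
transitivity (\int[P]_x (\int[T]_y (h x y v)%:E + (- (ln 2)^-1)%:E)); last first.
  rewrite integral_ge0D_integrable//; last 2 first.
  - by move=> x; exact: integral_ge0.
  - exact: finite_measure_integrable_cst.
  by rewrite integral_cst// [X in _ * X]probability_setT mule1.
apply: ae_eq_integral => //.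
- under eq_fun do rewrite REE entropy_density.
  apply: measurable_fun_ifT => //; last exact: emeasurable_funD.
  exact: measurable_fun_eqe.
- exact: emeasurable_funD.
- apply: filterS aeZ => x /(_ I) /= Z0 _; rewrite REE entropy_density.
  by case: ifPn => // /negP[]; exact/eqP.
Qed.

(** The identity [average_xlog2] is integrated over (y, v), and the integral [(ln 2)^-1] of
    [g / ln 2] cancels the correction contained in [h]. With the output term on the left, no
    finiteness is required. *)
Lemma mutual_informationE :
  mutual_information W Q rho P
    + \int[(T \x rho)%E]_z (xlog2 (g z) + (ln 2)^-1)%:E =
  \int[(T \x rho)%E]_z \int[P]_x (xlog2 (f x z.1 z.2) + (ln 2)^-1)%:E.
Proof.
rewrite /mutual_information; under eq_integral do rewrite integral_entropy.
have xg0 z : 0 <= (xlog2 (g z) + (ln 2)^-1)%:E.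
  by rewrite lee_fin -lerBlDr sub0r xlog2_ge.
have mxg : measurable_fun [set: Y * V] (fun z => (xlog2 (g z) + (ln 2)^-1)%:E).
  by apply/measurable_EFinP/measurable_funD => //; exact: measurable_xlog2_comp.
have mP : measurable_fun [set: V] (fun v => \int[P]_x \int[T]_y (h x y v)%:E).
  apply: (measurable_fun_fubini_tonelli_G (m1 := P)
    (fun q : X * V => \int[T]_y (h q.1 y q.2)%:E)).
    exact: (measurable_integral_output T mh h0).
  by move=> q; exact: integral_ge0.
rewrite integral_ge0D_integrable//; last 2 first.
- by move=> v; apply: integral_ge0 => x _; exact: integral_ge0.
- exact: finite_measure_integrable_cst.
rewrite integral_cst// [X in _ * X]probability_setT mule1.
rewrite -(integral_product_output T P rho mh)//.
have mhP := measurable_integral_input P mh h0.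
have mA : measurable_fun [set: Y * V]
    (fun z => \int[P]_x (xlog2 (f x z.1 z.2) + (ln 2)^-1)%:E).
  apply: (@measurable_integral_input _ _ _ X Y V R P
    (fun x y v => (xlog2 (f x y v) + (ln 2)^-1)%:E)).
    by apply/measurable_EFinP/measurable_funD => //; exact: measurable_xlog2_comp.
  by move=> x y v; rewrite lee_fin -lerBlDr sub0r xlog2_ge.
have gl0 z : 0 <= (g z / ln 2)%:E by rewrite lee_fin divr_ge0// ltW// ln2_gt0.
have mgl : measurable_fun [set: Y * V] (fun z => (g z / ln 2)%:E).
  by apply/measurable_EFinP; apply: measurable_funM.
have H : \int[(T \x rho)%E]_z \int[P]_x (h x z.1 z.2)%:E +
    \int[(T \x rho)%E]_z (xlog2 (g z) + (ln 2)^-1)%:E =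
    \int[(T \x rho)%E]_z \int[P]_x (xlog2 (f x z.1 z.2) + (ln 2)^-1)%:E +
    \int[(T \x rho)%E]_z (g z / ln 2)%:E.
  rewrite -!ge0_integralD//.
  - apply: eq_integral => -[y v] _ /=; apply: average_xlog2 => //.
    exact: (measurable_triple_comp mf (@measurable_id _ _ _) (measurable_cst y)
      (measurable_cst v)).
  - move=> z _; apply: integral_ge0 => x _.
    by rewrite lee_fin -lerBlDr sub0r xlog2_ge.
  - by move=> z _; exact: integral_ge0.
have gl1 : \int[(T \x rho)%E]_z (g z / ln 2)%:E = (ln 2)^-1%:E.
  transitivity (\int[rho]_v \int[T]_y (g (y, v) / ln 2)%:E).
    exact: (fubini_tonelli2 (fun z : Y * V => (g z / ln 2)%:E)).
  transitivity (\int[rho]_v (ln 2)^-1%:E); last first.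
    by rewrite integral_cst// [X in _ * X]probability_setT mule1.
  apply: eq_integral => v _; under eq_integral do rewrite mulrC EFinM.
  rewrite ge0_integralZl//= ?integral_g ?mule1//.
  - exact/measurable_EFinP.
  - by move=> y _; rewrite lee_fin.
  - by rewrite lee_fin invr_ge0 ltW// ln2_gt0.
rewrite addeAC H gl1 -addeA -EFinD subrr adde0//.
Qed.

End mutual_information_formula.

(** * Limits by uniform approximation, and truncation at a level *)

Section excess.
Context d (T : measurableType d) (R : realType).
Local Open Scope ereal_scope.

(** A uniform approximation argument in the extended reals: the error [e] is the same for all [n]
    and for the limit. *)
Lemma cvge_sandwich (a_ : nat -> \bar R) (a : \bar R) :
  (forall e : R, (0 < e)%R -> exists v_ : nat -> \bar R, exists v : R,
    [/\ v_ n @[n --> \oo] --> v%:E,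
        forall n, v_ n <= a_ n <= v_ n + e%:E & v%:E <= a <= v%:E + e%:E]) ->
  a_ n @[n --> \oo] --> a.
Proof.
(* Already the approximation with error 1 confines [a] between two reals. *)
move=> H; have afin : a \is a fin_num.
  have [_ [v [_ _ /andP[va av]]]] := H _ (@ltr01 R).
  by rewrite fin_numElt (lt_le_trans _ va) ?ltNyr// (le_lt_trans av)// -EFinD ltry.
rewrite -(fineK afin); apply/fine_cvgP; split.
  have [v_ [v [/fine_cvgP[vfin _] va _]]] := H _ (@ltr01 R).
  apply: filterS vfin => n vfin; have /andP[] := va n.
  rewrite -(fineK vfin) -EFinD => h1 h2.
  by rewrite fin_numElt (lt_le_trans _ h1) ?ltNyr// (le_lt_trans h2)// ltry.
apply/cvgrPdist_le => e e0.
have [v_ [v [/fine_cvgP[vfin vv] va /andP[av1 av2]]]] := H (e / 4)%R ltac:(lra).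
move/cvgrPdist_le : vv => /(_ (e / 4)%R ltac:(lra)) vv.
near=> n; have := va n.
have vnfin : v_ n \is a fin_num by near: n.
have vvn : (`|v - fine (v_ n)| <= e / 4)%R by near: n.
move: av1 av2; rewrite -(fineK afin) -(fineK vnfin) -!EFinD !lee_fin => av1 av2.
move=> /andP[h1 h2]; have anfin : a_ n \is a fin_num.
  by rewrite fin_numElt (lt_le_trans _ h1) ?ltNyr// (le_lt_trans h2)// ltry.
move: h1 h2; rewrite -(fineK anfin) !lee_fin/= => h1 h2.
by move: vvn; rewrite !ler_norml => /andP[h3 h4]; apply/andP; split; lra.
Unshelve. all: by end_near. Qed.

(** The excess of [q] over [c] is at most [|q|] where [|q| > c], and 0 elsewhere. *)
Lemma uniformly_integrable_excess (C : set {measure set T -> \bar R})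
    (q : T -> R) (e : R) : measurable_fun [set: T] q -> (0 < e)%R ->
  uniformly_integrable C q ->
  exists2 c : R, (0 <= c)%R & forall mu, C mu ->
    \int[mu]_t (Num.max (q t - c) 0)%:E <= e%:E.
Proof.
move=> mq e0 ui.
have e0' : 0 < e%:E by rewrite lte_fin.
have [M [_ ltM]] := ui _ (open_ereal_lt' e0').
(* Beyond [M] the supremum is below [e]; the 1 makes the inequality strict, and the maximum keeps
   the level nonnegative. *)
pose c : R := Num.max (M + 1)%R 0%R; exists c; first by rewrite le_max lexx orbT.
have Mc : (M < c)%R by rewrite lt_max ltrDl ltr01.
have c0 : (0 <= c)%R by rewrite le_max lexx orbT.
move=> mu Cmu; apply/ltW/(le_lt_trans _ (ltM _ Mc)).
apply: (@le_trans _ _ (\int[mu]_(t in [set t | (c < `|q t|)%R]) (`|q t|)%:E)).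
  have mS : measurable [set t | (c < `|q t|)%R].
    have mnq : measurable_fun [set: T] (fun t => `|q t|%R) by exact: measurableT_comp.
    have -> : [set t | (c < `|q t|)%R] =
        [set: T] `&` (fun t => `|q t|%R) @^-1` `]c, +oo[%classic.
      by apply/seteqP; split => t /=; rewrite in_itv/= andbT => // -[].
    by apply: mnq => //; exact: measurable_itv.
  have maq : measurable_fun [set: T] (fun t => (`|q t|)%:E).
    by apply/measurable_EFinP; exact: measurableT_comp.
  rewrite [leRHS]integral_mkcond; apply: ge0_le_integral => //.
  - by move=> t _; rewrite lee_fin le_max lexx orbT.
  - by apply/measurable_EFinP/measurable_maxr => //; exact: measurable_funB.
  - by apply/(measurable_restrictT _ mS); exact: measurable_funTS.
  - move=> t _; rewrite /patch; case: ifPn => [_|].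
      by rewrite lee_fin ge_max normr_ge0 andbT (le_trans _ (ler_norm _))// gerBl.
    rewrite notin_setE/= => /negP; rewrite -leNgt => qc.
    by rewrite lee_fin ge_max lexx andbT subr_le0 (le_trans (ler_norm _)).
by apply: ereal_sup_ubound; right; exists mu.
Qed.

Lemma continuous_minr (c : R) : continuous (fun t : R => Num.min t c)%R.
Proof.
under eq_fun do rewrite minr_absE.
move=> t; apply: cvgMl; apply: cvgB;
  first by apply: cvgD; [exact: cvg_id|exact: cvg_cst].
by apply: cvg_norm; apply: cvgB; [exact: cvg_id|exact: cvg_cst].
Qed.

Lemma min_add_excess (x c : R) : x = (Num.min x c + Num.max (x - c) 0)%R.
Proof. by rewrite minEle maxEle; case: ifPn; case: ifPn; lra. Qed.

End excess.

(** * The two entropy terms and their truncations *)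

Section entropy_terms.
Context dX dY dV (X : measurableType dX) (Y : measurableType dY)
  (V : measurableType dV) (R : realType).
Variables (T : {finite_measure set Y -> \bar R}) (rho : probability V R).
Variable f : X -> Y -> V -> R.
Local Open Scope ereal_scope.
Hypothesis mf : measurable_fun [set: X * Y * V] (fun p => f p.1.1 p.1.2 p.2).
Hypothesis f0 : forall x y v, (0 <= f x y v)%R.

(** Real-valued so that [xlog2] applies to it; [fine] loses nothing for the inputs covered by
    [averageE]. *)
Definition average (P : probability X R) (z : Y * V) : R :=
  fine (\int[P]_x (f x z.1 z.2)%:E).

(** Up to sign and the shift [(ln 2)^-1], the conditional entropy of the output given the input and
    the side information, relative to [T]. *)
Definition input_entropy (P : probability X R) : \bar R :=
  \int[(T \x rho)%E]_z \int[P]_x (xlog2 (f x z.1 z.2) + (ln 2)^-1)%:E.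

Definition output_entropy (P : probability X R) : \bar R :=
  \int[(T \x rho)%E]_z (xlog2 (average P z) + (ln 2)^-1)%:E.

(** For [c >= 0] this is continuous, with values between 0 and [c + (ln 2)^-1] on nonnegative reals,
    hence fit for weak* and dominated convergence. *)
Let truncated (c t : R) : R := (Num.min (xlog2 t) c + (ln 2)^-1)%R.

Let truncated_ge0 c t : (0 <= c)%R -> (0 <= t)%R -> (0 <= truncated c t)%R.
Proof.
move=> c0 t0; rewrite -lerBlDr sub0r le_min xlog2_ge//=.
by rewrite (le_trans _ c0)// oppr_le0 invr_ge0 ltW// ln2_gt0.
Qed.

Let truncated_le c t : (truncated c t <= c + (ln 2)^-1)%R.
Proof. by rewrite lerD2r ge_min lexx orbT. Qed.

Let xlog2_split c t : (xlog2 t + (ln 2)^-1 =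
  truncated c t + Num.max (xlog2 t - c) 0)%R.
Proof. by rewrite /truncated addrAC -min_add_excess. Qed.

Let continuous_truncated c : continuous (truncated c).
Proof.
move=> t; apply: cvgD; last exact: cvg_cst.
apply: (@cvg_comp _ _ _ xlog2 (fun s => Num.min s c)).
  exact: continuous_xlog2.
exact: continuous_minr.
Qed.

Let measurable_truncated c : measurable_fun [set: R] (truncated c).
Proof. exact: continuous_measurable_fun. Qed.

Let measurable_excess c :
  measurable_fun [set: R] (fun t : R => Num.max (xlog2 t - c) 0)%R.
Proof.
apply: measurable_maxr => //; apply: measurable_funB => //.
exact: measurable_xlog2.
Qed.

Let mfc (phi : R -> R) : measurable_fun [set: R] phi ->
  measurable_fun [set: X * Y * V] (fun p => (phi (f p.1.1 p.1.2 p.2))%:E).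
Proof.
by move=> mphi; apply/measurable_EFinP; exact: (measurableT_comp mphi mf).
Qed.

Let mfx (phi : R -> R) y v : measurable_fun [set: R] phi ->
  measurable_fun [set: X] (fun x => (phi (f x y v))%:E).
Proof.
move=> mphi; exact: (measurable_triple_comp
  (k := fun x y v => (phi (f x y v))%:E) (mfc mphi)
  (@measurable_id _ _ _) (measurable_cst y) (measurable_cst v)).
Qed.

Let truncated_input c (P : probability X R) : \bar R :=
  \int[(T \x rho)%E]_z \int[P]_x (truncated c (f x z.1 z.2))%:E.

Let truncated_output c (P : probability X R) : \bar R :=
  \int[(T \x rho)%E]_z (truncated c (average P z))%:E.

Let excess c (P : probability X R) : \bar R :=
  \int[(T \x rho)%E]_z \int[P]_x (Num.max (xlog2 (f x z.1 z.2) - c) 0)%:E.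

Section one_input.
Variable P : probability X R.
Hypothesis fP : forall y v, \int[P]_x (f x y v)%:E < +oo.

Lemma averageE y v : \int[P]_x (f x y v)%:E = (average P (y, v))%:E.
Proof.
rewrite fineK// ge0_fin_numE//; apply: integral_ge0 => x _.
by rewrite lee_fin.
Qed.

Let a0 z : (0 <= average P z)%R.
Proof. exact: (average_density_ge0 f0 averageE). Qed.

Let ma : measurable_fun [set: Y * V] (average P).
Proof. exact: (measurable_average_density mf f0 averageE). Qed.

Let mtrunc c : (0 <= c)%R ->
  measurable_fun [set: Y * V] (fun z => \int[P]_x (truncated c (f x z.1 z.2))%:E).
Proof.
move=> c0; apply: (measurable_integral_input P
  (k := fun x y v => (truncated c (f x y v))%:E) (mfc (measurable_truncated c))).
by move=> x y v; rewrite lee_fin truncated_ge0.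
Qed.

Let mexc c :
  measurable_fun [set: Y * V]
    (fun z => \int[P]_x (Num.max (xlog2 (f x z.1 z.2) - c) 0)%:E).
Proof.
apply: (measurable_integral_input P
  (k := fun x y v => (Num.max (xlog2 (f x y v) - c) 0)%:E)
  (mfc (measurable_excess c))).
by move=> x y v; rewrite lee_fin le_max lexx orbT.
Qed.

Let excess_ge0 c z : 0 <= \int[P]_x (Num.max (xlog2 (f x z.1 z.2) - c) 0)%:E.
Proof. by apply: integral_ge0 => x _; rewrite lee_fin le_max lexx orbT. Qed.

Lemma input_entropy_split c : (0 <= c)%R ->
  input_entropy P = truncated_input c P + excess c P.
Proof.
move=> c0; rewrite /truncated_input /excess -ge0_integralD//; last 2 first.
- by move=> z _; apply: integral_ge0 => x _; rewrite lee_fin truncated_ge0.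
- exact: mtrunc.
apply: eq_integral => z _; rewrite -ge0_integralD//; last 4 first.
- by move=> x _; rewrite lee_fin truncated_ge0.
- exact: mfx.
- by move=> x _; rewrite lee_fin le_max lexx orbT.
- exact: (mfx _ _ (measurable_excess c)).
by apply: eq_integral => x _; rewrite -EFinD -xlog2_split.
Qed.

Let productT : (T \x rho)%E [set: Y * V] = T [set: Y].
Proof.
by rewrite -setXTT product_measure1E// [X in _ * X]probability_setT mule1.
Qed.

Lemma truncated_input_le c : (0 <= c)%R ->
  truncated_input c P <= (c + (ln 2)^-1)%:E * T [set: Y].
Proof.
move=> c0; rewrite -productT -(integral_cst (T \x rho)%E)//.
apply: ge0_le_integral => //.
- by move=> z _; apply: integral_ge0 => x _; rewrite lee_fin truncated_ge0.
- exact: mtrunc.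
move=> z _; rewrite -[leRHS]mule1 -(@probability_setT _ _ _ P) -integral_cst//.
apply: ge0_le_integral => //.
- by move=> x _; rewrite lee_fin truncated_ge0.
- exact: mfx.
- by move=> x _; rewrite lee_fin truncated_le.
Qed.

Lemma truncated_output_le c : (0 <= c)%R ->
  truncated_output c P <= (c + (ln 2)^-1)%:E * T [set: Y].
Proof.
move=> c0; rewrite -productT -(integral_cst (T \x rho)%E)//.
apply: ge0_le_integral => //.
- by move=> z _; rewrite lee_fin truncated_ge0.
- by apply/measurable_EFinP; exact: measurableT_comp.
- by move=> z _; rewrite lee_fin truncated_le.
Qed.

(** By Jensen's inequality the excess of the averaged density is at most the averaged excess, so the
    error term is the same as for the input entropy. *)
Lemma output_entropy_bounds c : (0 <= c)%R ->
  truncated_output c P <= output_entropy P <= truncated_output c P + excess c P.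
Proof.
move=> c0; rewrite /output_entropy /truncated_output.
have mt : measurable_fun [set: Y * V] (fun z => (truncated c (average P z))%:E).
  by apply/measurable_EFinP; exact: measurableT_comp.
have mx : measurable_fun [set: Y * V] (fun z => (xlog2 (average P z) + (ln 2)^-1)%:E).
  by apply/measurable_EFinP/measurable_funD => //; exact: measurable_xlog2_comp.
apply/andP; split.
  apply: ge0_le_integral => //.
  - by move=> z _; rewrite lee_fin truncated_ge0.
  - move=> z _; rewrite (xlog2_split c) lee_fin lerDl le_max lexx orbT//.
rewrite -ge0_integralD//; last first.
  by move=> z _; rewrite lee_fin truncated_ge0.
apply: ge0_le_integral => //.
- by move=> z _; rewrite lee_fin -lerBlDr sub0r xlog2_ge.
- exact: emeasurable_funD.
move=> [y v] _; rewrite (xlog2_split c) EFinD leeD2l//.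
apply: jensen_xlog2_excess => //.
- by apply/measurable_EFinP; exact: (mfx (phi := id)).
- exact: averageE.
Qed.

End one_input.

(** * Uniform bounds over a collection of inputs, and weak* limits within it *)

Section weak_limit.
Variables (C : set (probability X R)) (P_ : nat -> probability X R)
  (P : probability X R).
Hypothesis finC : forall P y v, C P -> \int[P]_x (f x y v)%:E < +oo.
Hypothesis excC : forall e : R, (0 < e)%R -> exists2 c : R, (0 <= c)%R &
  forall P, C P ->
    \int[(T \x rho)%E]_z \int[P]_x (Num.max (xlog2 (f x z.1 z.2) - c) 0)%:E <= e%:E.

Let truncated_input_fin c (P' : probability X R) : C P' -> (0 <= c)%R ->
  truncated_input c P' \is a fin_num.
Proof.
move=> CP' c0; rewrite ge0_fin_numE.
  apply: (le_lt_trans (truncated_input_le _ c0)).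
  by rewrite ltey_eq fin_numM// fin_num_measure.
apply: integral_ge0 => z _; apply: integral_ge0 => x _.
by rewrite lee_fin truncated_ge0.
Qed.

Let truncated_output_fin c (P' : probability X R) : C P' -> (0 <= c)%R ->
  truncated_output c P' \is a fin_num.
Proof.
move=> CP' c0; have fP' y v := @finC P' y v CP'; rewrite ge0_fin_numE.
  apply: (le_lt_trans (truncated_output_le fP' c0)).
  by rewrite ltey_eq fin_numM// fin_num_measure.
apply: integral_ge0 => z _; rewrite lee_fin truncated_ge0//.
exact: (average_density_ge0 f0 (averageE fP')).
Qed.

Let input_entropy_bounds c e (P' : probability X R) : (0 <= c)%R -> excess c P' <= e ->
  truncated_input c P' <= input_entropy P' <= truncated_input c P' + e.
Proof.
move=> c0 ce; rewrite (input_entropy_split _ c0) leeD2l// andbT leeDl//.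
apply: integral_ge0 => z _; apply: integral_ge0 => x _.
by rewrite lee_fin le_max lexx orbT.
Qed.

Let output_entropy_bounds' c e (P' : probability X R) :
  C P' -> (0 <= c)%R -> excess c P' <= e ->
  truncated_output c P' <= output_entropy P' <= truncated_output c P' + e.
Proof.
move=> CP' c0 ce; have fP' y v := @finC P' y v CP'.
have /andP[-> /le_trans ->//] := output_entropy_bounds fP' c0.
by rewrite leeD2l.
Qed.

Lemma input_entropy_ge0 (P' : probability X R) : 0 <= input_entropy P'.
Proof.
apply: integral_ge0 => z _; apply: integral_ge0 => x _.
by rewrite lee_fin -lerBlDr sub0r xlog2_ge.
Qed.

Lemma output_entropy_ge0 P' : C P' -> 0 <= output_entropy P'.
Proof.
move=> CP'; apply: integral_ge0 => z _; rewrite lee_fin -lerBlDr sub0r xlog2_ge//.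
by apply: (average_density_ge0 f0 (averageE _)) => y v; exact: finC.
Qed.

Lemma entropy_bounded : exists M : R, forall P', C P' ->
  input_entropy P' <= M%:E /\ output_entropy P' <= M%:E.
Proof.
have [c c0 cP] := excC (@ltr01 R).
(* The truncated part is at most [c + (ln 2)^-1] times the mass of [T], and the excess at level [c]
   is at most 1. *)
pose M := (c + (ln 2)^-1)%:E * T [set: Y] + 1%:E.
have Mfin : M \is a fin_num by rewrite fin_numD fin_numM// fin_num_measure.
exists (fine M) => P' CP'; rewrite fineK//; split.
  have /andP[_ /le_trans->//] := input_entropy_bounds c0 (cP _ CP').
  by rewrite leeD2r// truncated_input_le.
have /andP[_ /le_trans->//] := output_entropy_bounds' CP' c0 (cP _ CP').
by rewrite leeD2r// truncated_output_le// => y v; exact: finC.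
Qed.

Hypotheses (CP_ : forall n, C (P_ n)) (CP : C P).
Hypothesis weakP : forall (phi : R -> R) y v, continuous phi ->
  (exists M, forall t, (0 <= t)%R -> (`|phi t| <= M)%R) ->
  \int[P_ n]_x (phi (f x y v))%:E @[n --> \oo] --> \int[P]_x (phi (f x y v))%:E.

(** The density may be unbounded in [x], hence no test function; its truncation at [c] is one, and
    the excess is uniformly small over [C]. *)
Lemma average_cvg y v :
  (forall e : R, (0 < e)%R -> exists2 c : R, (0 <= c)%R &
     forall P, C P -> \int[P]_x (Num.max (f x y v - c) 0)%:E <= e%:E) ->
  average (P_ n) (y, v) @[n --> \oo] --> average P (y, v).
Proof.
move=> exc; apply: fine_cvg.
rewrite -(averageE (fun y v => @finC P y v CP)).
pose m (P' : probability X R) c := \int[P']_x (Num.min (f x y v) c)%:E.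
have mmin c : measurable_fun [set: R] (fun t : R => Num.min t c).
  by apply: continuous_measurable_fun; exact: continuous_minr.
have mmax c : measurable_fun [set: R] (fun t : R => Num.max (t - c) 0)%R.
  by apply: measurable_maxr => //; exact: measurable_funB.
have min0 c x : (0 <= c)%R -> 0 <= (Num.min (f x y v) c)%:E.
  by move=> c0; rewrite lee_fin le_min f0.
have bounds (P' : probability X R) c e : (0 <= c)%R ->
    \int[P']_x (Num.max (f x y v - c) 0)%:E <= e ->
    m P' c <= \int[P']_x (f x y v)%:E <= m P' c + e.
  move=> c0 ce; have -> : \int[P']_x (f x y v)%:E =
      m P' c + \int[P']_x (Num.max (f x y v - c) 0)%:E.
    rewrite -ge0_integralD//.
    - by apply: eq_integral => x _; rewrite -EFinD -min_add_excess.
    - by move=> x _; exact: min0.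
    - exact: (mfx _ _ (mmin c)).
    - by move=> x _; rewrite lee_fin le_max lexx orbT.
    - exact: (mfx _ _ (mmax c)).
  rewrite leeD2l// andbT leeDl//; apply: integral_ge0 => x _.
  by rewrite lee_fin le_max lexx orbT.
apply: cvge_sandwich => e e0; have [c c0 cP] := exc e e0.
exists (fun n => m (P_ n) c), (fine (m P c)).
rewrite fineK; last first.
  rewrite ge0_fin_numE; last by apply: integral_ge0 => x _; exact: min0.
  have /andP[/le_lt_trans + _] := bounds P c e%:E c0 (cP _ CP).
  by apply; exact: finC.
split; last 2 first.
- by move=> n; apply: bounds => //; exact: cP.
- by apply: bounds => //; exact: cP.
apply: (weakP (phi := fun t => Num.min t c)); first exact: continuous_minr.
exists c => t t0; rewrite ger0_norm; first by rewrite ge_min lexx orbT.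
by rewrite le_min t0.
Qed.

(** At each (y, v) the truncated inner integrals converge by [weakP]; a constant dominates them, and
    [T \x rho] is finite. *)
Lemma input_entropy_cvg :
  input_entropy (P_ n) @[n --> \oo] --> input_entropy P.
Proof.
apply: cvge_sandwich => e e0; have [c c0 cP] := excC e0.
exists (fun n => truncated_input c (P_ n)), (fine (truncated_input c P)).
rewrite fineK ?truncated_input_fin//; split; last 2 first.
- by move=> n; apply: input_entropy_bounds => //; exact: cP.
- by apply: input_entropy_bounds => //; exact: cP.
have mt P' := @measurable_integral_input _ _ _ X Y V R P'
  (fun x y v => (truncated c (f x y v))%:E) (mfc (measurable_truncated c))
  (fun x y v => truncated_ge0 c0 (f0 x y v)).
apply: (@dominated_cvg _ _ _ (finite_product T rho) _ measurableT
  (fun n z => \int[P_ n]_x (truncated c (f x z.1 z.2))%:E)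
  (fun z => \int[P]_x (truncated c (f x z.1 z.2))%:E)
  (EFin \o cst (c + (ln 2)^-1)%R)) => //.
- move=> [y v] _; apply: weakP; first exact: continuous_truncated.
  by exists (c + (ln 2)^-1)%R => t t0; rewrite ger0_norm ?truncated_ge0.
- exact: finite_measure_integrable_cst.
- move=> n z _; rewrite gee0_abs; last first.
    by apply: integral_ge0 => x _; rewrite lee_fin truncated_ge0.
  rewrite -[leRHS]mule1 -(@probability_setT _ _ _ (P_ n)) -integral_cst//.
  apply: ge0_le_integral => //.
  + by move=> x _; rewrite lee_fin truncated_ge0.
  + exact: mfx.
  + by move=> x _; rewrite lee_fin truncated_le.
Qed.

(** Pointwise convergence of the averages passes through the continuous truncation, and dominated
    convergence concludes. *)
Lemma output_entropy_cvg :
  (forall y v, average (P_ n) (y, v) @[n --> \oo] --> average P (y, v)) ->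
  output_entropy (P_ n) @[n --> \oo] --> output_entropy P.
Proof.
move=> avg; apply: cvge_sandwich => e e0; have [c c0 cP] := excC e0.
exists (fun n => truncated_output c (P_ n)), (fine (truncated_output c P)).
rewrite fineK ?truncated_output_fin//; split; last 2 first.
- by move=> n; apply: output_entropy_bounds' => //; exact: cP.
- by apply: output_entropy_bounds' => //; exact: cP.
have fP_ n y v := @finC (P_ n) y v (CP_ n).
apply: (@dominated_cvg _ _ _ (finite_product T rho) _ measurableT
  (fun n z => (truncated c (average (P_ n) z))%:E)
  (fun z => (truncated c (average P z))%:E)
  (EFin \o cst (c + (ln 2)^-1)%R)) => //.
- move=> n; apply/measurable_EFinP; apply: measurableT_comp => //.
  exact: (measurable_average_density mf f0 (averageE (fP_ n))).
- move=> [y v] _; apply: cvg_EFin; first exact: nearW.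
  exact: (cvg_comp _ _ (avg y v) (@continuous_truncated c _)).
- exact: finite_measure_integrable_cst.
- move=> n z _ /=; rewrite lee_fin ger0_norm// truncated_ge0//.
  exact: (average_density_ge0 f0 (averageE (fP_ n))).
Qed.

End weak_limit.
End entropy_terms.

(** * Boundedness and weak* continuity of the mutual information *)

Theorem theorem3p3 (R : realType) (X Y S V : ptopologicalType)
    (hX : separable_lch X) (hY : separable_lch Y)
    (hS : separable_lch S) (hV : separable_lch V)
    (W : R.-pker (borel X * borel S) ~> borel Y)
    (hW : forall x s, radon (W (x, s)))
    (Q : R.-pker (borel V) ~> borel S)
    (rho : probability (borel V) R)
    (PA : set (probability (borel X) R))
    (hPA : forall P, PA P -> radon P)
    (hPA_closed : wstar_closed PA)
    (T : {finite_measure set (borel Y) -> \bar R})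
    (hT : forall x v, side_channel W Q v x `<< T)
    (f : X -> Y -> V -> R)
    (hf : forall x v, is_density (side_channel W Q v x) T (fun y => f x y v))
    (hf_meas : measurable_fun [set: borel X * borel Y * borel V]
                 (fun p => f p.1.1 p.1.2 p.2))
    (ha_cont : continuous (fun p : X * Y * V => f p.1.1 p.1.2 p.2))
    (ha_ui : uniformly_integrable
               [set product3 T P rho | P in PA]
               (fun p : borel Y * borel X * borel V =>
                  f p.1.2 p.1.1 p.2 * log2 (f p.1.2 p.1.1 p.2)))
    (hb : forall y v, uniformly_integrable
               [set (P : {measure set (borel X) -> \bar R}) | P in PA]
               (fun x : borel X => f x y v)) :
  bounded_on PA (mutual_information W Q rho) /\
  wstar_continuous_on PA (mutual_information W Q rho).
Proof.
have f0 (x : borel X) (y : borel Y) (v : borel V) : 0 <= f x y v by case: (hf x v).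
have finC (P : probability (borel X) R) (y : borel Y) (v : borel V) :
    PA P -> (\int[P]_x (f x y v)%:E < +oo)%E.
  move=> PAP.
  have mfx : measurable_fun [set: borel X] (fun x => f x y v).
    exact: (measurable_triple_comp hf_meas (@measurable_id _ _ _)
      (measurable_cst y) (measurable_cst v)).
  (* Hypothesis (b) makes the excess of [f] over some [c] integrate to at most 1; the average of [f]
     is then at most [1 + c]. *)
  have [c c0 cP] := uniformly_integrable_excess mfx ltr01 (hb y v).
  have {cP} : (\int[P]_x (Num.max (f x y v - c) 0)%:E <= 1%:E)%E.
    by apply: cP; exists P.
  move=> h; apply: (@le_lt_trans _ _
      (\int[P]_x ((Num.max (f x y v - c) 0)%:E + c%:E))%E).
    apply: ge0_le_integral => //.
    - by move=> x _; rewrite lee_fin.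
    - exact/measurable_EFinP.
    - apply: emeasurable_funD => //; apply/measurable_EFinP.
      by apply: measurable_maxr => //; exact: measurable_funB.
    - by move=> x _; rewrite -EFinD lee_fin -lerBlDr le_max lexx.
  rewrite ge0_integralD//; last 2 first.
  - by move=> x _; rewrite lee_fin le_max lexx orbT.
  - by apply/measurable_EFinP/measurable_maxr => //; exact: measurable_funB.
  rewrite integral_cst// [X in (_ * X)%E]probability_setT mule1.
  by rewrite lte_add_pinfty ?ltry// (le_lt_trans h)// ltry.
(* The same function, typed on the Borel measurable spaces. *)
pose F : borel X -> borel Y -> borel V -> R := f.
have avgE P (PAP : PA P) := averageE f0 (fun y v => @finC P y v PAP).
have excC e : 0 < e -> exists2 c : R, 0 <= c & forall P, PA P ->
    (\int[(T \x rho)%E]_z \int[P]_x (Num.max (xlog2 (f x z.1 z.2) - c) 0)%:E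
      <= e%:E)%E.
  move=> e0.
  have mq : measurable_fun [set: borel Y * borel X * borel V]
      (fun p => xlog2 (f p.1.2 p.1.1 p.2)).
    apply: measurable_xlog2_comp.
    exact: (measurable_triple_comp hf_meas
      (@measurable_fst_snd _ _ _ (borel Y) (borel X) (borel V))
      (@measurable_fst_fst _ _ _ (borel Y) (borel X) (borel V)) measurable_snd).
  have [c c0 cP] := uniformly_integrable_excess mq e0 ha_ui.
  exists c => // P PAP.
  have mk : measurable_fun [set: borel X * borel Y * borel V]
      (fun p => (Num.max (xlog2 (f p.1.1 p.1.2 p.2) - c) 0)%:E).
    apply/measurable_EFinP/measurable_maxr => //; apply: measurable_funB => //.
    exact: measurable_xlog2_comp.
  have := @integral_product3 _ _ _ _ _ _ R T P rho
    (fun x y v => (Num.max (xlog2 (f x y v) - c) 0)%:E) mk.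
  move=> <-; last by move=> x y v; rewrite lee_fin le_max lexx orbT.
  by apply: cP; exists P.
have Bfin P : PA P -> output_entropy T rho F P \is a fin_num.
  move=> PAP; have [M MP] := entropy_bounded hf_meas f0 finC excC.
  rewrite ge0_fin_numE; last exact: (output_entropy_ge0 T rho f0 finC).
  by rewrite (le_lt_trans (MP P PAP).2)// ltry.
(* Since the output term is finite, it can be moved to the other side of the formula. *)
have IE P : PA P -> mutual_information W Q rho P =
    (input_entropy T rho F P - output_entropy T rho F P)%E.
  move=> PAP; rewrite /input_entropy.
  rewrite -(mutual_informationE rho hf hf_meas (avgE P PAP)).
  by rewrite addeK// Bfin.
split.
  have [M MP] := entropy_bounded hf_meas f0 finC excC.
  exists M => P PAP; have [AM BM] := MP P PAP.
  have A0 := input_entropy_ge0 T rho f0 P.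
  have B0 := output_entropy_ge0 T rho f0 finC PAP.
  have Afin : input_entropy T rho F P \is a fin_num.
    by rewrite ge0_fin_numE// (le_lt_trans AM)// ltry.
  have Bf := Bfin P PAP.
  move: AM BM A0 B0; rewrite IE// -(fineK Afin) -(fineK Bf) -EFinB !lee_fin.
  by move=> AM BM A0 B0; rewrite ler_norml; apply/andP; split; lra.
move=> P_ P PAP_ PAP PcvgP.
have cont y v : continuous (fun x : X => f x y v).
  move=> x; have xyv : {for x, continuous (fun x : X => (x, y, v))}.
    apply: (@cvg_pair _ _ _ _ (nbhs (x, y)) (nbhs v)); last exact: cvg_cst.
    by apply: (@cvg_pair _ _ _ _ (nbhs x) (nbhs y)); [exact: cvg_id|exact: cvg_cst].
  exact: (continuous_comp xyv (ha_cont (x, y, v))).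
(* A bound for [phi] on nonnegative reals suffices because [f >= 0]; the truncation of the identity
   is unbounded below on the whole line. *)
have weakP (phi : R -> R) (y : borel Y) (v : borel V) : continuous phi ->
  (exists M : R, forall t, 0 <= t -> `|phi t| <= M) ->
  (\int[P_ n]_x (phi (f x y v))%:E @[n --> \oo] --> \int[P]_x (phi (f x y v))%:E)%E.
  move=> cphi [M phiM]; apply: (PcvgP (fun x => phi (f x y v))); split.
    by move=> x; apply: continuous_comp; [exact: cont|exact: cphi].
  exists M; split; first exact: num_real.
  by move=> r Mr x _; exact: le_trans (phiM _ (f0 x y v)) (ltW Mr).
have Acvg := input_entropy_cvg hf_meas f0 excC PAP_ PAP weakP.
have Bcvg : (output_entropy T rho F (P_ n) @[n --> \oo] --> output_entropy T rho F P)%E.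
  apply: (output_entropy_cvg hf_meas f0 finC excC PAP_ PAP) => y v.
  (* Hypothesis (b) supplies the uniform control of the excess of [f] at fixed (y, v). *)
  apply: (average_cvg hf_meas f0 finC PAP_ PAP weakP) => e e0.
  have mfx : measurable_fun [set: borel X] (fun x => f x y v).
    exact: (measurable_triple_comp hf_meas (@measurable_id _ _ _)
      (measurable_cst y) (measurable_cst v)).
  have [c c0 cP] := uniformly_integrable_excess mfx e0 (hb y v).
  by exists c => // P' PAP'; apply: cP; exists P'.
rewrite IE//; under eq_fun do rewrite IE//.
by apply: cvgeB => //; apply: fin_num_adde_defl; rewrite fin_numN Bfin.
Qed.
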